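(* Let $K$ be a field and let $n\ge 2$ be an integer. Let $F$ be either the free associative $K$-algebra on the set of free generators $X=\{x_{1}, x_{2}, \ldots ,x_{n}\}$, or the formal free (noncommutative) power series algebra over $K$ in $n$ variables $x_{1}, \ldots , x_{n}$. Let $d=2$ if $n=2$, and let $d={n(n+1)\over 2}-2$ if $n>2$. Let $f_{1}, f_{2}, \ldots , f_{d}\in F$ be $d$ elements such that if we write each of $f_{1}, \ldots , f_{d}$ as a sum of words (with coefficients in $K$), then each word has degree two or higher. Let $I$ be the two-sided ideal of $F$ generated by $f_{1},\ldots ,f_{d}$. If $F/I$ is finite dimensional over $K$, then $F/I$ is not commutative.
   Context: The degree of a word in $x_1,\ldots,x_n$ is its length. The elements $f_1,\ldots,f_d$ need not be homogeneous. *)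

(* Defs.v *)
From HB Require Import structures.
From mathcomp Require Import all_boot all_algebra.
From mathcomp Require Import boolp.
From mathcomp Require Export monalg.

Set Implicit Arguments.
Unset Strict Implicit.
Unset Printing Implicit Defensive.

Import GRing.Theory.
Local Open Scope ring_scope.

(* Words in x_1, ..., x_n are the elements of the free monoid {fmonom 'I_n} of
   multinomials; a power series is the family of its coefficients. *)

Definition ncseries (R : Type) (n : nat) : Type := {fmonom 'I_n} -> R.

Section NCSeriesLmodule.
Context (R : pzRingType) (n : nat).
Implicit Types (f g h : ncseries R n) (w : {fmonom 'I_n}).

HB.instance Definition _ := gen_eqMixin (ncseries R n).
HB.instance Definition _ := gen_choiceMixin (ncseries R n).

Definition ncs0 : ncseries R n := fun=> 0.
Definition ncs_opp f : ncseries R n := fun w => - f w.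
Definition ncs_add f g : ncseries R n := fun w => f w + g w.
Definition ncs_scale (a : R) f : ncseries R n := fun w => a * f w.

Fact ncs_addA : associative ncs_add.
Proof. by move=> f g h; apply/funext => w; rewrite /ncs_add addrA. Qed.

Fact ncs_addC : commutative ncs_add.
Proof. by move=> f g; apply/funext => w; rewrite /ncs_add addrC. Qed.

Fact ncs_add0 : left_id ncs0 ncs_add.
Proof. by move=> f; apply/funext => w; rewrite /ncs_add add0r. Qed.

Fact ncs_addN : left_inverse ncs0 ncs_opp ncs_add.
Proof. by move=> f; apply/funext => w; rewrite /ncs_add addNr. Qed.

HB.instance Definition _ := GRing.isZmodule.Build (ncseries R n)
  ncs_addA ncs_addC ncs_add0 ncs_addN.

Lemma ncsE0 w : (0 : ncseries R n) w = 0. Proof. by []. Qed.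
Lemma ncsED f g w : (f + g) w = f w + g w. Proof. by []. Qed.
Lemma ncsEN f w : (- f) w = - f w. Proof. by []. Qed.

Fact ncs_scaleA a b f : ncs_scale a (ncs_scale b f) = ncs_scale (a * b) f.
Proof. by apply/funext => w; rewrite /ncs_scale mulrA. Qed.

Fact ncs_scale1 : left_id 1 ncs_scale.
Proof. by move=> f; apply/funext => w; rewrite /ncs_scale mul1r. Qed.

Fact ncs_scaleDr : right_distributive ncs_scale +%R.
Proof. by move=> a f g; apply/funext => w; rewrite /ncs_scale mulrDr. Qed.

Fact ncs_scaleDl f : {morph ncs_scale^~ f : a b / a + b}.
Proof. by move=> a b; apply/funext => w; rewrite /ncs_scale mulrDl. Qed.

HB.instance Definition _ := GRing.Zmodule_isLmodule.Build R (ncseries R n)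
  ncs_scaleA ncs_scale1 ncs_scaleDr ncs_scaleDl.

Lemma ncsEZ a f w : (a *: f) w = a * f w. Proof. by []. Qed.

End NCSeriesLmodule.

Section NCSeriesRing.
Context (R : nzRingType) (n : nat).
Implicit Types (f g h : ncseries R n) (w : {fmonom 'I_n}).

Definition ncs1 : ncseries R n := fun w => (fdeg w == 0%N)%:R.

(* The sum runs over the factorizations of w into two words. *)
Definition ncs_mul f g : ncseries R n := fun w =>
  \sum_(i < (size w).+1) f (FMonom (take i w)) * g (FMonom (drop i w)).

Fact ncs_mulA : associative ncs_mul.
Proof.
move=> f g h; apply/funext => w; rewrite /ncs_mul.
set s : seq 'I_n := w.
pose F i j := f (FMonom (take i s)) * g (FMonom (take j (drop i s)))
              * h (FMonom (drop j (drop i s))).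
have -> : \sum_(i < (size s).+1) f (FMonom (take i s)) *
   (\sum_(j < (size (drop i s)).+1) g (FMonom (take j (drop i s)))
      * h (FMonom (drop j (drop i s))))
   = \sum_(i < (size s).+1) \sum_(k < (size s).+1 | (i <= k)%N) F i (k - i)%N.
  apply: eq_bigr => -[i /= ilt] _; rewrite mulr_sumr.
  transitivity (\sum_(j < (size (drop i s)).+1) F i j).
    by apply: eq_bigr => j _; rewrite mulrA.
  rewrite -(big_mkord xpredT (F i)) -(big_mkord (fun k => i <= k)%N
    (fun k => F i (k - i)%N)).
  rewrite [RHS](@big_cat_nat _ _ _ i) //=; last by rewrite ltnW.
  rewrite [X in _ = X + _]big_nat_cond [X in _ = X + _]big1 ?add0r; last first.
    by move=> k /andP[ki ik]; move: ki; rewrite ltnNge ik.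
  rewrite size_drop -subSn // [RHS]big_mkcond /=.
  have -> G : \sum_(i <= k < (size s).+1) G k
    = \sum_(0 <= k < (size s).+1 - i) G (k + i)%N :> R.
    by rewrite -{1}[i]add0n big_addn.
  by apply: eq_bigr => k _; rewrite leq_addl addnK.
rewrite (exchange_big_dep xpredT) //=.
apply: eq_bigr => -[k /= klt] _; rewrite mulr_suml.
rewrite size_take_min (minn_idPl _) //.
rewrite (big_ord_widen_cond (size s).+1 xpredT (fun i : nat =>
  f (FMonom (take i (take k s))) * g (FMonom (drop i (take k s)))
  * h (FMonom (drop k s)))) //=.
apply: eq_big => [i|i ik]; first by rewrite ltnS.
by rewrite /F take_takel // drop_drop subnK // take_drop subnK.
Qed.

Fact ncs_mul1l : left_id ncs1 ncs_mul.
Proof.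
move=> f; apply/funext => w; rewrite /ncs_mul big_ord_recl /= big1.
  by rewrite take0 drop0 fmK /ncs1 mul1r addr0.
move=> i _; rewrite /ncs1 fdegE size_takel; last by rewrite /bump /= add1n.
by rewrite /bump /= mul0r.
Qed.

Fact ncs_mul1r : right_id ncs1 ncs_mul.
Proof.
move=> f; apply/funext => w; rewrite /ncs_mul big_ord_recr /= big1.
  by rewrite take_size drop_size fmK /ncs1 mulr1 add0r.
move=> i _; rewrite /ncs1 fdegE size_drop subn_eq0 leqNgt ltn_ord.
by rewrite mulr0.
Qed.

Fact ncs_mulDl : left_distributive ncs_mul +%R.
Proof.
move=> f g h; apply/funext => w; rewrite ncsED /ncs_mul -big_split.
by apply: eq_bigr => i _; rewrite mulrDl.
Qed.

Fact ncs_mulDr : right_distributive ncs_mul +%R.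
Proof.
move=> f g h; apply/funext => w; rewrite ncsED /ncs_mul -big_split.
by apply: eq_bigr => i _; rewrite mulrDr.
Qed.

Fact ncs1_neq0 : ncs1 != 0.
Proof.
apply/eqP => /(congr1 (fun f : ncseries R n => f (FMonom [::]))) /eqP.
by rewrite /ncs1 /= oner_eq0.
Qed.

HB.instance Definition _ := GRing.Zmodule_isNzRing.Build (ncseries R n)
  ncs_mulA ncs_mul1l ncs_mul1r ncs_mulDl ncs_mulDr ncs1_neq0.

Lemma ncsE1 w : (1 : ncseries R n) w = (fdeg w == 0%N)%:R. Proof. by []. Qed.

Lemma ncsEM f g w : (f * g) w =
  \sum_(i < (size w).+1) f (FMonom (take i w)) * g (FMonom (drop i w)).
Proof. by []. Qed.

Fact ncs_scaleAl (a : R) f g : a *: (f * g) = (a *: f) * g.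
Proof.
apply/funext => w; rewrite ncsEZ !ncsEM mulr_sumr.
by apply: eq_bigr => i _; rewrite mulrA.
Qed.

HB.instance Definition _ := GRing.Lmodule_isLalgebra.Build R (ncseries R n)
  ncs_scaleAl.

End NCSeriesRing.

Fact ncs_scaleAr (R : comNzRingType) (n : nat) (a : R) (f g : ncseries R n) :
  a *: (f * g) = f * (a *: g).
Proof.
apply/funext => w; rewrite ncsEZ !ncsEM mulr_sumr.
by apply: eq_bigr => i _; rewrite mulrCA.
Qed.

HB.instance Definition _ (R : comNzRingType) (n : nat) :=
  GRing.Lalgebra_isAlgebra.Build R (ncseries R n) (@ncs_scaleAr R n).

(* ring_quotient.v only makes {ideal_quot I} a ring when the base ring is
   commutative.  Ideals are not required to be proper here, hence pzRingType. *)

HB.mixin Record isTwoSided (R : pzRingType) (S : R -> bool) := {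
  idealMl : forall a u : R, u \in S -> a * u \in S;
  idealMr : forall u a : R, u \in S -> u * a \in S
}.

#[short(type="twoSidedIdeal")]
HB.structure Definition TwoSidedIdeal (R : pzRingType) :=
  {S of GRing.ZmodClosed R S & isTwoSided R S}.

Definition ideal_quotient (R : pzRingType) (I : twoSidedIdeal R) : Type :=
  Quotient.quot I.

Section IdealQuotientRing.
Context (R : pzRingType) (I : twoSidedIdeal R).
Local Notation Q := (ideal_quotient I).

HB.instance Definition _ := GRing.Zmodule.on Q.
HB.instance Definition _ := EqQuotient.on Q.

Definition quot_pi (x : R) : Q := \pi_(Quotient.quot I)%qT x.

Lemma quot_piP (x y : R) : quot_pi x = quot_pi y <-> x - y \in I.
Proof. by split=> [/eqP|xy]; last apply/eqP; rewrite -Quotient.idealrBE. Qed.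

Lemma quot_pi_surj (q : Q) : exists x, quot_pi x = q.
Proof. by exists (repr q); rewrite /quot_pi reprK. Qed.

Lemma quot_pi_repr (q : Q) : quot_pi (repr q) = q.
Proof. by rewrite /quot_pi reprK. Qed.

Lemma quot_piB : {morph quot_pi : x y / x - y}.
Proof. by move=> x y; rewrite /quot_pi raddfB. Qed.

HB.instance Definition _ := GRing.isZmodMorphism.Build R Q quot_pi quot_piB.

Definition quot_one : Q := quot_pi 1.
Definition quot_mul (p q : Q) : Q := quot_pi (repr p * repr q).

Lemma quot_mulE x y : quot_mul (quot_pi x) (quot_pi y) = quot_pi (x * y).
Proof.
rewrite /quot_mul; apply/quot_piP.
set x' := repr _; set y' := repr _.
have xI : x' - x \in I by apply/quot_piP/quot_pi_repr.
have yI : y' - y \in I by apply/quot_piP/quot_pi_repr.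
have -> : x' * y' - x * y = x' * (y' - y) + (x' - x) * y.
  by rewrite mulrBr mulrBl addrA subrK.
by apply: rpredD; [apply: idealMl | apply: idealMr].
Qed.

Fact quot_mulA : associative quot_mul.
Proof.
move=> p q r; have [x <-] := quot_pi_surj p; have [y <-] := quot_pi_surj q.
by have [z <-] := quot_pi_surj r; rewrite !quot_mulE mulrA.
Qed.

Fact quot_mul1l : left_id quot_one quot_mul.
Proof. by move=> p; have [x <-] := quot_pi_surj p; rewrite quot_mulE mul1r. Qed.

Fact quot_mul1r : right_id quot_one quot_mul.
Proof. by move=> p; have [x <-] := quot_pi_surj p; rewrite quot_mulE mulr1. Qed.

Fact quot_mulDl : left_distributive quot_mul +%R.
Proof.
move=> p q r; have [x <-] := quot_pi_surj p; have [y <-] := quot_pi_surj q.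
have [z <-] := quot_pi_surj r.
by rewrite -raddfD !quot_mulE mulrDl raddfD.
Qed.

Fact quot_mulDr : right_distributive quot_mul +%R.
Proof.
move=> p q r; have [x <-] := quot_pi_surj p; have [y <-] := quot_pi_surj q.
have [z <-] := quot_pi_surj r.
by rewrite -raddfD !quot_mulE mulrDr raddfD.
Qed.

HB.instance Definition _ := GRing.Zmodule_isPzRing.Build Q
  quot_mulA quot_mul1l quot_mul1r quot_mulDl quot_mulDr.

Fact quot_pi_monoid : monoid_morphism quot_pi.
Proof. by split=> // x y; rewrite -quot_mulE. Qed.

HB.instance Definition _ := GRing.isMonoidMorphism.Build R Q quot_pi
  quot_pi_monoid.

End IdealQuotientRing.

Section IdealQuotientLmodule.
Context (K : pzRingType) (A : lalgType K) (I : twoSidedIdeal A).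
Local Notation Q := (ideal_quotient I).

Definition quot_scale (a : K) (q : Q) : Q := quot_pi I (a *: repr q).

Lemma quot_scaleE a (x : A) :
  quot_scale a (quot_pi I x) = quot_pi I (a *: x).
Proof.
rewrite /quot_scale; apply/quot_piP; rewrite -scalerBr -mulr_algl.
by apply/idealMl/quot_piP/quot_pi_repr.
Qed.

Fact quot_scaleA a b q : quot_scale a (quot_scale b q) = quot_scale (a * b) q.
Proof. by have [x <-] := quot_pi_surj q; rewrite !quot_scaleE scalerA. Qed.

Fact quot_scale1 : left_id 1 quot_scale.
Proof.
by move=> q; have [x <-] := quot_pi_surj q; rewrite quot_scaleE scale1r.
Qed.

Fact quot_scaleDr : right_distributive quot_scale +%R.
Proof.
move=> a p q; have [x <-] := quot_pi_surj p; have [y <-] := quot_pi_surj q.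
by rewrite -raddfD !quot_scaleE scalerDr raddfD.
Qed.

Fact quot_scaleDl q : {morph quot_scale^~ q : a b / a + b}.
Proof.
move=> a b; have [x <-] := quot_pi_surj q.
by rewrite !quot_scaleE scalerDl raddfD.
Qed.

HB.instance Definition _ := GRing.Zmodule_isLmodule.Build K Q
  quot_scaleA quot_scale1 quot_scaleDr quot_scaleDl.

Fact quot_pi_scalable : scalable (quot_pi I).
Proof. by move=> a x; rewrite -quot_scaleE. Qed.

HB.instance Definition _ := GRing.isScalable.Build K A Q *:%R (quot_pi I)
  quot_pi_scalable.

End IdealQuotientLmodule.

Record is_ideal (R : pzRingType) (J : R -> Prop) : Prop := IsIdeal {
  is_ideal0 : J 0;
  is_idealB : forall x y, J x -> J y -> J (x - y);
  is_idealMl : forall a x, J x -> J (a * x);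
  is_idealMr : forall x a, J x -> J (x * a)
}.

Definition gen_ideal (R : pzRingType) (T : Type) (f : T -> R) (x : R) : bool :=
  `[< forall J : R -> Prop, is_ideal J -> (forall i, J (f i)) -> J x >].

Section GeneratedIdeal.
Context (R : pzRingType) (T : Type) (f : T -> R).

Lemma gen_idealP x :
  reflect (forall J : R -> Prop, is_ideal J -> (forall i, J (f i)) -> J x)
    (x \in gen_ideal f).
Proof. exact: asboolP. Qed.

Fact gen_ideal_zmod_closed : zmod_closed (gen_ideal f).
Proof.
split=> [|x y /gen_idealP xI /gen_idealP yI]; apply/gen_idealP => J Ji Jf.
  exact: is_ideal0.
by apply: is_idealB => //; [apply: xI | apply: yI].
Qed.

HB.instance Definition _ := GRing.isZmodClosed.Build R (gen_ideal f)
  gen_ideal_zmod_closed.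

Fact gen_ideal_Ml a u : u \in gen_ideal f -> a * u \in gen_ideal f.
Proof.
move=> /gen_idealP uI; apply/gen_idealP => J Ji Jf.
by apply: (is_idealMl Ji); apply: uI.
Qed.

Fact gen_ideal_Mr u a : u \in gen_ideal f -> u * a \in gen_ideal f.
Proof.
move=> /gen_idealP uI; apply/gen_idealP => J Ji Jf.
by apply: (is_idealMr Ji); apply: uI.
Qed.

HB.instance Definition _ := isTwoSided.Build R (gen_ideal f)
  gen_ideal_Ml gen_ideal_Mr.

Definition ideal_gen : twoSidedIdeal R :=
  TwoSidedIdeal.clone R (gen_ideal f) _.

Lemma mem_ideal_gen i : f i \in ideal_gen.
Proof. by apply/gen_idealP => J _; apply. Qed.

Lemma ideal_genP x :
  reflect (forall J : R -> Prop, is_ideal J -> (forall i, J (f i)) -> J x)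
    (x \in ideal_gen).
Proof. exact: gen_idealP. Qed.

End GeneratedIdeal.

Definition finite_dim (K : fieldType) (V : lmodType K) : Prop :=
  exists m : nat, inhabited (Vector.axiom m V).

(* Main.v *)
(* If F/I is commutative then I contains every commutator [x_i, x_j].  The ideal
   I lies in the square of the augmentation ideal M, so IM + MI only involves
   words of length at least three and the commutators with i < j are linearly
   independent modulo IM + MI.  Hence, modulo IM + MI, at most d - C(n,2) of the
   generators survive in the image J of I in K[x_1, ..., x_n], that is, in J/MJ.
   But J has finite codimension, and Nakayama's lemma makes m generators of J/MJ
   into generators g_1, ..., g_m of J modulo any power M^T.  If v_1, ..., v_D
   span a complement of J, then the products of the v_j with the monomials of
   degree less than T in the g_l span K[x]/M^T.  There are O(T^m) of them, while
   K[x]/M^T has dimension of order T^n, so m >= n and d >= C(n+1,2). *)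
Require Import Defs.
From mathcomp Require Import all_boot all_algebra.
From HB Require Import structures.
From mathcomp Require Import boolp.
From mathcomp Require mpoly.

Set Implicit Arguments.
Unset Strict Implicit.
Unset Printing Implicit Defensive.

Import GRing.Theory.
Local Open Scope ring_scope.

(** * Closure properties of two-sided ideals *)

Section Ideals.
Context (R : pzRingType) (J : R -> Prop) (idJ : is_ideal J).

Lemma is_idealN x : J x -> J (- x).
Proof. by rewrite -sub0r; apply: is_idealB (is_ideal0 idJ). Qed.

Lemma is_idealD x y : J x -> J y -> J (x + y).
Proof.
by move=> Jx /is_idealN Jy; rewrite -[y]opprK; apply: is_idealB.
Qed.

Lemma is_ideal_sum (I : Type) (r : seq I) (P : pred I) (x : I -> R) :
  (forall i, P i -> J (x i)) -> J (\sum_(i <- r | P i) x i).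
Proof. by move=> Jx; apply: big_ind => //; [exact: is_ideal0 | exact: is_idealD]. Qed.

End Ideals.

(** * Adjoining finitely many generators to an ideal of a commutative ring *)

Section IdealAdjoin.
Context (R : comPzRingType) (J : R -> Prop) (idJ : is_ideal J).

Definition ideal_adjoin m (g : 'I_m -> R) (p : R) : Prop :=
  exists c : 'I_m -> R, J (p - \sum_l c l * g l).

Lemma ideal_adjoin_is_ideal m (g : 'I_m -> R) : is_ideal (ideal_adjoin g).
Proof.
have adjM a p : ideal_adjoin g p -> ideal_adjoin g (a * p).
  move=> [c Jc]; exists (fun l => a * c l).
  under eq_bigr do rewrite -mulrA.
  by rewrite -mulr_sumr -mulrBr; apply: is_idealMl.
split=> [|p q [c Jc] [e Je]||p a]; last by rewrite mulrC; apply: adjM.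
- exists (fun=> 0); rewrite big1 ?subr0; first exact: is_ideal0.
  by move=> l _; rewrite mul0r.
- exists (fun l => c l - e l).
  under eq_bigr do rewrite mulrBl.
  rewrite sumrB opprB addrACA [- q - _]addrC -addrACA -(opprB q).
  exact: is_idealB.
- exact: adjM.
Qed.

Lemma ideal_adjoin_sub m (g : 'I_m -> R) p : J p -> ideal_adjoin g p.
Proof.
by move=> Jp; exists (fun=> 0); rewrite big1 ?subr0 // => l _; rewrite mul0r.
Qed.

Lemma ideal_adjoin_gen m (g : 'I_m -> R) l : ideal_adjoin g (g l).
Proof.
exists (fun k => (k == l)%:R); rewrite (bigD1 l) //= eqxx mul1r big1.
  by rewrite addr0 subrr; apply: is_ideal0.
by move=> k /negPf ->; rewrite mul0r.
Qed.

End IdealAdjoin.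

(* [mpoly] redefines names of [monalg], hence the local import. *)
Section CommutativeImage.
Import mpoly.

(** * The order filtration $M^k$ on commutative polynomials *)

Section MpolyOrder.
Context (K : fieldType) (n : nat).
Local Notation S := {mpoly K[n]}.
Implicit Types (p q : S).

Definition mord_ge k p : Prop := forall m, (mdeg m < k)%N -> p@_m = 0.

Lemma mord_ge0 p : mord_ge 0 p. Proof. by []. Qed.

Lemma mord_geW k l p : (k <= l)%N -> mord_ge l p -> mord_ge k p.
Proof. by move=> kl pl m mk; apply: pl; apply: leq_trans kl. Qed.

Lemma mord_geM k l p q : mord_ge k p -> mord_ge l q -> mord_ge (k + l) (p * q).
Proof.
move=> pk ql m mkl; rewrite mcoeffM big1 // => -[m1 m2] /= /eqP def_m.
have [lt1|le1] := ltnP (mdeg m1) k; first by rewrite pk // mul0r.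
rewrite ql ?mulr0 // -(ltn_add2l (mdeg m1)) -mdegD -def_m.
by apply: leq_trans mkl _; rewrite leq_add2r.
Qed.

Lemma mord_ge_is_ideal k : is_ideal (mord_ge k).
Proof.
split=> [m _|p q pk qk m mk|p q qk|p q pk]; first by rewrite mcoeff0.
- by rewrite mcoeffB pk ?qk ?subrr.
- by rewrite -[k]add0n; apply: mord_geM.
- by rewrite -[k]addn0; apply: mord_geM.
Qed.

Lemma mord_geX i : mord_ge 1 ('X_i : S).
Proof.
move=> m; rewrite ltnS leqn0 mdeg_eq0 => /eqP->.
by rewrite mcoeffX -mdeg_eq0 mdeg1.
Qed.

Lemma mord_geZ k (a : K) p : mord_ge k p -> mord_ge k (a *: p).
Proof. by move=> pk; rewrite -mul_mpolyC; apply: (is_idealMl (mord_ge_is_ideal k)). Qed.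

Lemma mord_ge_mmap1 m (g : 'I_m -> S) (b : 'X_{1..m}) :
  (forall l, mord_ge 1 (g l)) -> mord_ge (mdeg b) (mmap1 g b).
Proof.
move=> g1; rewrite mdegE /mmap1.
apply: (big_ind2 (fun k p => mord_ge k p)) => //.
  by move=> *; apply: mord_geM.
move=> l _; elim: (b l) => [|k IH]; first exact: mord_ge0.
by rewrite exprS -add1n; apply: mord_geM.
Qed.

(** Nakayama modulo $M^T$: rewriting $a F_k$ as $a (F_k - \sum_j b_j F_j) + \sum_j (a b_j) F_j$
    raises the order of the coefficients by one, and after $T$ rounds these lie in $M^T$, hence in
    [Q]. *)
Lemma mord_nakayama T d (F : 'I_d -> S) (Q : S -> Prop) : is_ideal Q ->
    (forall p, mord_ge T p -> Q p) ->
    (forall k, exists2 b : 'I_d -> S, (forall j, mord_ge 1 (b j)) &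
       Q (F k - \sum_j b j * F j)) ->
  forall k, Q (F k).
Proof.
move=> idQ QT nak.
(* Here [s] counts the rounds left before the coefficient [a] reaches order [T]; the start [s = T],
   [a = 1] carries no order condition. *)
suff low s a k : mord_ge (T - s) a -> Q (a * F k).
  by move=> k; rewrite -[F k]mul1r; apply: (low T); rewrite subnn.
elim: s a k => [|s IH] a k aT.
  by apply: (is_idealMr idQ); apply: QT; rewrite subn0 in aT.
have [b b1 Qb] := nak k.
rewrite -[F k](subrK (\sum_j b j * F j)) mulrDr.
apply: (is_idealD idQ); first exact: is_idealMl.
rewrite mulr_sumr; apply: (is_ideal_sum idQ) => j _; rewrite mulrA.
apply: IH; apply: mord_geW (mord_geM aT (b1 j)).
by rewrite addn1 subnS leqSpred.
Qed.

(** The coefficients [e l] are themselves expanded by the hypothesis, again and again. Each round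
    contributes one more factor [g l] of order at least one, so all that is left after [T] rounds
    has order [T]. *)
Lemma span_adic T m D (g : 'I_m -> S) (v : 'I_D -> S) :
    (forall l, mord_ge 1 (g l)) ->
    (forall p, exists (c : 'I_D -> K) (e : 'I_m -> S),
       mord_ge T (p - \sum_j c j *: v j - \sum_l e l * g l)) ->
  forall p, exists C : 'X_{1..m < T} * 'I_D -> K,
    mord_ge T (p - \sum_s C s *: (mmap1 g s.1 * v s.2)).
Proof.
move=> g1 Sgv.
pose U p := exists C : 'X_{1..m < T} * 'I_D -> K,
    mord_ge T (p - \sum_s C s *: (mmap1 g s.1 * v s.2)).
have idT := mord_ge_is_ideal T.
have UT p : mord_ge T p -> U p.
  move=> pT; exists (fun=> 0); rewrite big1 ?subr0 // => s _.
  by rewrite scale0r.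
have UD p q : U p -> U q -> U (p + q).
  move=> [C pC] [E qE]; exists (fun s => C s + E s).
  under eq_bigr do rewrite scalerDl.
  by rewrite big_split opprD addrACA; exact: (is_idealD idT).
have Usum I r (P : pred I) (x : I -> S) :
    (forall i, P i -> U (x i)) -> U (\sum_(i <- r | P i) x i).
  by move=> Ux; apply: big_ind => //; apply: UT; apply: (is_ideal0 idT).
have Ugen (b : 'X_{1..m < T}) j a : U (a *: (mmap1 g b * v j)).
  exists (fun s => if s == (b, j) then a else 0).
  rewrite (bigD1 (b, j)) //= eqxx big1 ?addr0 ?subrr; first exact: (is_ideal0 idT).
  by move=> s /negPf ->; rewrite scale0r.
(* Induction on a bound [s] for the number of factors [g l] still missing from [mmap1 g b]. *)
suff Ug s (b : 'X_{1..m}) p : (T <= mdeg b + s)%N -> U (mmap1 g b * p).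
  by move=> p; have := @Ug T 0%MM p; rewrite mmap11 mul1r leq_addl; apply.
elim: s b p => [|s IH] b p.
  rewrite addn0 => Tb; apply: UT; apply: (is_idealMr idT).
  exact: mord_geW Tb (mord_ge_mmap1 g1).
move=> Tb; have [Tb'|bT] := leqP T (mdeg b).
  apply: UT; apply: (is_idealMr idT).
  exact: mord_geW Tb' (mord_ge_mmap1 g1).
have [c [e pce]] := Sgv p.
rewrite -[p](subrK (\sum_j c j *: v j)) mulrDr; apply: (UD).
  rewrite -[p - _](subrK (\sum_l e l * g l)) mulrDr; apply: (UD).
    by apply: UT; apply: (is_idealMl idT).
  rewrite mulr_sumr; apply: Usum => l _; rewrite [e l * _]mulrC mulrA.
  have -> : mmap1 g b * g l = mmap1 g (b + U_(l))%MM.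
    by rewrite commr_mmap1_M ?mmap1U // => *; apply: mulrC.
  by apply: IH; rewrite mdegD mdeg1 addn1 addSnnS.
rewrite mulr_sumr; apply: Usum => j _; rewrite -scalerAr.
exact: (Ugen (BMultinom bT)).
Qed.

(** Errors of order [T] do not touch coefficients in degree below [T]. So the matrix of expansions
    of the monomials times the coefficient matrix of [u] is an identity matrix factoring through
    dimension [N]. *)
Lemma card_bmultinom_le T N (I : finType) (u : I -> S) :
    (forall p, exists C : I -> K, mord_ge T (p - \sum_s C s *: u s)) ->
    #|I| = N ->
  (#|{: 'X_{1..n < T}}| <= N)%N.
Proof.
move=> Su <-.
have /choice [C CP] (b : 'X_{1..n < T}) := Su 'X_[b].
pose A := \matrix_(i < #|{: 'X_{1..n < T}}|, s < #|I|) C (enum_val i) (enum_val s).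
pose B := \matrix_(s < #|I|, i < #|{: 'X_{1..n < T}}|)
  (u (enum_val s))@_(enum_val i).
apply: (@mulmx1_min K _ _ A B); apply/matrixP => i j; rewrite !mxE.
have := CP (enum_val i) (enum_val j) (bmdeg _).
rewrite mcoeffB mcoeffX => /eqP; rewrite subr_eq0 => /eqP.
rewrite (inj_eq val_inj) (inj_eq enum_val_inj) => ->.
rewrite raddf_sum /= [RHS](reindex (@enum_val I predT)) /=; last first.
  by apply: onW_bij; apply: enum_val_bij.
by apply: eq_bigr => s _; rewrite !mxE mcoeffZ.
Qed.

End MpolyOrder.

(** * Growth of the number of monomials of bounded degree *)

Lemma leq_card_bmultinom m T : (#|{: 'X_{1..m < T}}| <= T ^ m)%N.
Proof.
pose h (b : 'X_{1..m < T}) : {ffun 'I_m -> 'I_T} :=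
  [ffun i => insubd (Ordinal (bmdeg b)) (b i)].
have hE b i : h b i = (b : 'X_{1..m}) i :> nat.
  rewrite ffunE val_insubd ifT //; apply: leq_ltn_trans (bmdeg b).
  by rewrite mdegE (bigD1 i) //= leq_addr.
rewrite -[X in (X ^ _)%N]card_ord -[in X in (_ <= X)%N](card_ord m) -card_ffun.
apply: (leq_card h) => b c bc; apply/val_inj/mnmP => i.
by rewrite -!hE bc.
Qed.

(** Exponent vectors with all entries below [t] have total degree at most $n (t-1)$. *)
Lemma card_bmultinom_geq n t : (0 < n)%N -> (0 < t)%N ->
  (t ^ n <= #|{: 'X_{1..n < n * t}}|)%N.
Proof.
move=> n0 t0.
have bd (h : {ffun 'I_n -> 'I_t}) :
    (mdeg [multinom (h i : nat) | i < n] < n * t)%N.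
  rewrite mdegE; apply: (@leq_ltn_trans (\sum_(i < n) t.-1)%N).
    by apply: leq_sum => i _; rewrite mnmE -ltnS prednK.
  by rewrite sum_nat_const card_ord ltn_pmul2l // prednK.
rewrite -[X in (X ^ _)%N]card_ord -[in X in (X <= _)%N](card_ord n) -card_ffun.
apply: (leq_card (fun h => BMultinom (bd h))) => h k /(congr1 val) /mnmP hk.
by apply/ffunP => i; apply: val_inj; have := hk i; rewrite !mnmE.
Qed.

Lemma bmultinom_growth n D : exists T, forall m, (m < n)%N ->
  (#|{: 'X_{1..m < T}}| * D < #|{: 'X_{1..n < T}}|)%N.
Proof.
(* With $T = n t$ the left side is at most $(n t)^{n-1} D = t^{n-1} (n^{n-1} D)$, and [t] is chosen
   just above $n^{n-1} D$, so this is below $t^n$. *)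
pose t := (n ^ n.-1 * D).+1; exists (n * t)%N => m mn.
have n0 : (0 < n)%N by apply: leq_ltn_trans mn.
apply: leq_trans (card_bmultinom_geq n0 (ltn0Sn _)).
have nt0 : (0 < n * t)%N by rewrite muln_gt0 n0.
apply: (@leq_ltn_trans ((n * t) ^ n.-1 * D)).
  rewrite leq_mul2r (leq_trans (leq_card_bmultinom _ _)) ?orbT //.
  by rewrite leq_pexp2l // -ltnS prednK.
have -> : (t ^ n = t ^ n.-1 * t)%N by rewrite -expnSr prednK.
by rewrite expnMn -mulnA mulnCA ltn_pmul2l ?expn_gt0.
Qed.

(** * Order of noncommutative series and removal of the first letter *)

Section NCSeriesOrder.
Context (K : fieldType) (n : nat).
Local Notation A := (ncseries K n).
Implicit Types (f g : A) (w : {fmonom 'I_n}).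

Definition ncord_ge k f : Prop := forall w, (fdeg w < k)%N -> f w = 0.

Lemma ncord_geW k l f : (k <= l)%N -> ncord_ge l f -> ncord_ge k f.
Proof. by move=> kl fl w wk; apply: fl; apply: leq_trans kl. Qed.

Lemma ncord_geM k l f g : ncord_ge k f -> ncord_ge l g -> ncord_ge (k + l) (f * g).
Proof.
move=> fk gl w wkl; rewrite ncsEM big1 // => -[i /= iw] _.
have [ik|ki] := ltnP i k; first by rewrite fk ?mul0r // fdegE size_takel.
rewrite gl ?mulr0 // fdegE size_drop ltn_subLR //.
by apply: leq_trans wkl _; rewrite leq_add2r.
Qed.

Lemma ncord_ge_is_ideal k : is_ideal (ncord_ge k).
Proof.
split=> [w _|f g fk gk w wk|f g gk|f g fk] //.
- by rewrite ncsED ncsEN fk ?gk ?subrr.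
- by rewrite -[k]add0n; apply: ncord_geM.
- by rewrite -[k]addn0; apply: ncord_geM.
Qed.

Definition ncX (i : 'I_n) : A := fun w => (w == FMonom [:: i])%:R.

(** The left quotient of [f] by the letter $x_i$. It obeys a one-sided Leibniz rule, [ncderivM], in
    which the constant term of the first factor appears. *)
Definition ncderiv (i : 'I_n) f : A := fun w => f (FMonom (i :: w)).

Lemma ncderivD i f g : ncderiv i (f + g) = ncderiv i f + ncderiv i g.
Proof. by []. Qed.

Lemma ncderivZ i a f : ncderiv i (a *: f) = a *: ncderiv i f.
Proof. by []. Qed.

Lemma ncderivM i f g :
  ncderiv i (f * g) = ncderiv i f * g + f (FMonom [::]) *: ncderiv i g.
Proof.
apply/funext => w; rewrite ncsED ncsEZ ncsEM {1}/ncderiv ncsEM /=.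
by rewrite big_ord_recl /= addrC.
Qed.

Lemma ncderivX i j : ncderiv i (ncX j) = (i == j)%:R *: 1.
Proof.
apply/funext => w; rewrite ncsEZ ncsE1 /ncderiv /ncX -val_eqE /= eqseq_cons.
by rewrite -natrM mulnb; case: w => -[].
Qed.

Lemma ncderiv1 i : ncderiv i 1 = 0.
Proof. by []. Qed.

Lemma ncord_ge_deriv k i f : ncord_ge k.+1 f -> ncord_ge k (ncderiv i f).
Proof. by move=> fk w wk; apply: fk. Qed.

(** The coefficients at increasing words of length two separate the commutators: this is their
    linear independence modulo order three. The reversed product $x_j x_i$ never contributes,
    because its word is decreasing. *)
Lemma ncX_swap (i j k l : 'I_n) : (i < j)%N -> (k < l)%N ->
  (ncX i * ncX j - ncX j * ncX i) (FMonom [:: k; l]) = ((i == k) && (j == l))%:R.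
Proof.
move=> ij kl; rewrite ncsED ncsEN !ncsEM /= !big_ord_recl !big_ord0 /=.
rewrite /ncX -!val_eqE /= !eqseq_cons !andbT !(mul0r, mulr0, add0r, addr0).
rewrite -!natrM !mulnb ![k == _]eq_sym ![l == _]eq_sym.
have /negPf -> : ~~ ((j == k) && (i == l)).
  by apply: contraTN ij => /andP[/eqP-> /eqP->]; rewrite -leqNgt ltnW.
by rewrite subr0.
Qed.

End NCSeriesOrder.

(** * The truncated commutative image of a series *)

Section Abelianization.
Context (K : fieldType) (n : nat).
Local Notation A := (ncseries K n).
Local Notation S := {mpoly K[n]}.
Implicit Types (f g : A).

(* The image of [f] in the commutative power series, modulo degree [T], computed
   from [f = f(1) + \sum_i x_i * ncderiv i f]. *)
Fixpoint abel T f : S :=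
  if T is T'.+1 then (f (FMonom [::]))%:MP + \sum_i 'X_i * abel T' (ncderiv i f)
  else 0.

Lemma abel_is_linear T : linear (abel T).
Proof.
elim: T => [|T IH] a f g /=; first by rewrite scaler0 addr0.
under eq_bigr do rewrite ncderivD ncderivZ IH mulrDr -scalerAr.
rewrite big_split /= -scaler_sumr ncsED ncsEZ mpolyCD mpolyCM mul_mpolyC.
by rewrite scalerDr addrACA.
Qed.

HB.instance Definition _ T :=
  GRing.isLinear.Build K A S _ (abel T) (abel_is_linear T).

Lemma abel_ge T k f : ncord_ge k f -> mord_ge k (abel T f).
Proof.
elim: T k f => [|T IH] k f fk /=; first exact: is_ideal0 (mord_ge_is_ideal _ _ k).
case: k fk => [|k] fk; first exact: mord_ge0.
rewrite fk // mpolyC0 add0r.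
apply: (is_ideal_sum (mord_ge_is_ideal _ _ k.+1)) => i _.
by rewrite -add1n; apply: mord_geM (@mord_geX _ _ i) _; apply/IH/ncord_ge_deriv.
Qed.

(** The two truncations differ only by the words of length exactly [T]. *)
Lemma abelS T f : mord_ge T (abel T.+1 f - abel T f).
Proof.
elim: T f => [|T IH] f; first exact: mord_ge0.
rewrite [abel T.+2 f]/= [abel T.+1 f]/= addrAC opprD addrA subrr add0r addrC.
rewrite -sumrB; apply: (is_ideal_sum (mord_ge_is_ideal _ _ T.+1)) => i _.
rewrite -mulrBr -add1n; apply: mord_geM; first exact: mord_geX.
exact: IH.
Qed.

Lemma abelM T f g : mord_ge T (abel T (f * g) - abel T f * abel T g).
Proof.
have idl := mord_ge_is_ideal K n.
elim: T f g => [|T IH] f g; first exact: mord_ge0.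
set f0 := f (FMonom [::]); set h := abel T.+1 g.
(* By the Leibniz rule the terms $f_0 \partial_i g$, together with the constant term of $f g$,
   reassemble to $f_0 h$, which cancels against the constant part of [f] times [h]. *)
have -> : abel T.+1 (f * g) - abel T.+1 f * h =
    \sum_i 'X_i * (abel T (ncderiv i f * g) - abel T (ncderiv i f) * h).
  rewrite /= -/f0 mulrDl mul_mpolyC {1}/h /= scalerDr.
  rewrite ncsEM big_ord1 mpolyCM mul_mpolyC -/f0.
  under eq_bigr do rewrite ncderivM linearD linearZ /= mulrDr -scalerAr.
  under [in RHS]eq_bigr do rewrite mulrBr mulrA.
  rewrite big_split sumrB -mulr_suml -scaler_sumr /=.
  rewrite addrCA opprD -addrA; congr (_ + _).
  by rewrite -/f0 addrA addrN add0r.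
apply: (is_ideal_sum (idl T.+1)) => i _.
rewrite -add1n; apply: mord_geM; first exact: mord_geX.
(* Induction applies to [abel T g], whereas [h] is truncated one degree later; [abelS] bounds the
   difference. *)
rewrite -[abel T _](subrK (abel T (ncderiv i f) * abel T g)) -addrA -mulrBr.
apply: (is_idealD (idl T)); first exact: IH.
by apply: (is_idealMl (idl T)); rewrite -opprB; apply: (is_idealN (idl T)); apply: abelS.
Qed.

Lemma abel1 T : mord_ge T (abel T 1 - 1).
Proof.
case: T => [|T]; first exact: mord_ge0.
rewrite /= big1 => [|i _]; last by rewrite ncderiv1 linear0 mulr0.
by rewrite addr0 subrr; apply: is_ideal0 (mord_ge_is_ideal _ _ _).
Qed.

Lemma abelX T i : mord_ge T (abel T (ncX K i) - 'X_i).
Proof.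
case: T => [|T]; first exact: mord_ge0.
rewrite /= /ncX /= mpolyC0 add0r.
have -> : \sum_j 'X_j * abel T (ncderiv j (ncX K i)) = 'X_i * abel T 1 :> S.
  rewrite (bigD1 i) //= ncderivX eqxx scale1r big1 ?addr0 // => j /negPf ji.
  by rewrite ncderivX ji scale0r linear0 mulr0.
rewrite -[X in _ - X]mulr1 -mulrBr -add1n; apply: mord_geM _ (@abel1 T).
exact: mord_geX.
Qed.

Lemma abel_mon T (a : 'X_{1..n}) :
  mord_ge T (abel T (\prod_i ncX K i ^+ a i) - 'X_[a]).
Proof.
have idT := mord_ge_is_ideal K n T.
have MM f g p q : mord_ge T (abel T f - p) -> mord_ge T (abel T g - q) ->
    mord_ge T (abel T (f * g) - p * q).
  move=> fp gq; rewrite -[abel T _](subrK (abel T f * abel T g)) -addrA.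
  apply: (is_idealD idT); first exact: abelM.
  rewrite -[abel T f](subrK p) mulrDl -addrA -mulrBr.
  by apply: (is_idealD idT); [apply: (is_idealMr idT) | apply: (is_idealMl idT)].
rewrite mpolyXE_id.
apply: (big_ind2 (fun f p => mord_ge T (abel T f - p))) => [|f p g q|i _].
- exact: abel1.
- exact: MM.
elim: (a i) => [|k IH]; first exact: abel1.
by rewrite !exprS; apply: MM => //; apply: abelX.
Qed.

Lemma abel_comm T f g : mord_ge T (abel T (f * g - g * f)).
Proof.
rewrite linearB /= -[X in X - _](subrK (abel T f * abel T g)) -addrA.
apply: (is_idealD (mord_ge_is_ideal K n T)); first exact: abelM.
rewrite -opprB; apply: (is_idealN (mord_ge_is_ideal K n T)).
by rewrite mulrC; apply: abelM.
Qed.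

End Abelianization.

(** * Elements of the generated ideal and their commutative images *)

Section GeneratedIdealSeries.
Context (K : fieldType) (n d : nat) (h : 'I_d -> ncseries K n).
Local Notation A := (ncseries K n).
Local Notation S := {mpoly K[n]}.

(** Although [abel T] is multiplicative only modulo $M^T$, the target contains $M^T$, so its
    preimage is a two-sided ideal, and it contains the generators. *)
Lemma abel_ideal_gen T (u : A) : u \in ideal_gen h ->
  ideal_adjoin (mord_ge T) (fun k => abel T (h k)) (abel T u).
Proof.
pose J (v : A) := ideal_adjoin (mord_ge T) (fun k => abel T (h k)) (abel T v).
move=> /ideal_genP/(_ J); apply; last first.
  by move=> k; apply: (ideal_adjoin_gen (mord_ge_is_ideal K n T)).
have idT := mord_ge_is_ideal K n T.
have idQ := ideal_adjoin_is_ideal idT (fun k => abel T (h k)).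
have QM (a v : A) : ideal_adjoin (mord_ge T) (fun k => abel T (h k))
    (abel T a * abel T v) -> J (a * v).
  move=> Qav; rewrite /J -[abel T _](subrK (abel T a * abel T v)).
  by apply: (is_idealD idQ) => //; apply: ideal_adjoin_sub; apply: abelM.
split=> [|v w Qv Qw|a v Qv|v a Qv].
- by rewrite /J linear0; apply: (is_ideal0 idQ).
- by rewrite /J linearB; apply: (is_idealB idQ Qv).
- by apply/QM/(is_idealMl idQ).
- by apply/QM/(is_idealMr idQ).
Qed.

Hypothesis h2 : forall k, ncord_ge 2 (h k).

Lemma ideal_gen_ord2 (u : A) : u \in ideal_gen h -> ncord_ge 2 u.
Proof. by move=> /ideal_genP/(_ (ncord_ge 2)); apply => //; apply: ncord_ge_is_ideal. Qed.

Let lead T (u : A) := exists (c : 'I_d -> K) (b : 'I_d -> S),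
  [/\ forall j, mord_ge 1 (b j),
      ncord_ge 3 (u - \sum_k c k *: h k) &
      mord_ge T (abel T (u - \sum_k c k *: h k) - \sum_j b j * abel T (h j))].

Let leadD T (u v : A) : lead T u -> lead T v -> lead T (u + v).
Proof.
move=> [c [b [b1 u3 uT]]] [e [b' [b1' v3 vT]]].
exists (fun k => c k + e k), (fun j => b j + b' j).
have -> : \sum_k (c k + e k) *: h k = \sum_k c k *: h k + \sum_k e k *: h k.
  by rewrite -big_split; apply: eq_bigr => k _; rewrite scalerDl.
have -> : \sum_j (b j + b' j) * abel T (h j) =
    \sum_j b j * abel T (h j) + \sum_j b' j * abel T (h j).
  by rewrite -big_split; apply: eq_bigr => k _; rewrite mulrDl.
rewrite opprD addrACA; split.
- by move=> j; apply: (is_idealD (mord_ge_is_ideal K n 1)).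
- exact: (is_idealD (ncord_ge_is_ideal K n 3)).
- rewrite linearD /= opprD addrACA.
  exact: (is_idealD (mord_ge_is_ideal K n T)).
Qed.

Let leadZ T a (u : A) : lead T u -> lead T (a *: u).
Proof.
move=> [c [b [b1 u3 uT]]]; exists (fun k => a * c k), (fun j => a *: b j).
have -> : \sum_k (a * c k) *: h k = a *: \sum_k c k *: h k.
  by rewrite scaler_sumr; apply: eq_bigr => k _; rewrite scalerA.
rewrite -scalerBr; split=> [j|w w3|].
- exact: mord_geZ.
- by rewrite ncsEZ u3 ?mulr0.
- have -> : \sum_j a *: b j * abel T (h j) = a *: \sum_j b j * abel T (h j).
    by rewrite scaler_sumr; apply: eq_bigr => k _; rewrite scalerAl.
  by rewrite linearZ -scalerBr; apply: mord_geZ.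
Qed.

Let lead_deep T (u : A) (b : 'I_d -> S) : (forall j, mord_ge 1 (b j)) ->
  ncord_ge 3 u -> mord_ge T (abel T u - \sum_j b j * abel T (h j)) -> lead T u.
Proof.
move=> b1 u3 uT; exists (fun=> 0), b.
by rewrite [X in u - X]big1 ?subr0 // => k _; rewrite scale0r.
Qed.

(* This is I = span h + (IM + MI): the remainder has order three since I lies in
   M^2, and its commutative image lies in MJ. *)
Lemma ideal_gen_lead T (u : A) : u \in ideal_gen h ->
  exists (c : 'I_d -> K) (b : 'I_d -> S),
  [/\ forall j, mord_ge 1 (b j),
      ncord_ge 3 (u - \sum_k c k *: h k) &
      mord_ge T (abel T (u - \sum_k c k *: h k) - \sum_j b j * abel T (h j))].
Proof.
have idT := mord_ge_is_ideal K n T.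
have id1 := mord_ge_is_ideal K n 1.
have split1 (a : A) : {a0 & {a1 | ncord_ge 1 a1 & a = a0%:A + a1}}.
  exists (a (FMonom [::])), (a - (a (FMonom [::]))%:A); last by rewrite addrC subrK.
  move=> [[|//] _]; by rewrite ncsED ncsEN ncsEZ ncsE1 mulr1 subrr.
have abelP (a v : A) : v \in ideal_gen h -> ncord_ge 1 a ->
    exists2 b : 'I_d -> S, (forall j, mord_ge 1 (b j)) &
    mord_ge T (abel T a * abel T v - \sum_j b j * abel T (h j)).
  move=> /(abel_ideal_gen T)[e vT] a1; exists (fun j => abel T a * e j).
    by move=> j; apply: (is_idealMr id1); apply: abel_ge.
  under eq_bigr do rewrite -mulrA.
  by rewrite -mulr_sumr -mulrBr; apply: (is_idealMl idT).
have leadM (p : A) (q : S) : ncord_ge 3 p -> mord_ge T (abel T p - q) ->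
    (exists2 b : 'I_d -> S, (forall j, mord_ge 1 (b j)) &
      mord_ge T (q - \sum_j b j * abel T (h j))) -> lead T p.
  move=> p3 pq [b b1 qT]; apply: (lead_deep b1 p3).
  by rewrite -[abel T p](subrK q) -addrA; apply: (is_idealD idT).
move=> uI; suff [] : u \in ideal_gen h /\ lead T u by [].
(* Membership is carried along with [lead], since the product steps use both that [v] has order two
   and that its image lies in the ideal of the images of the generators. *)
pose J (v : A) := v \in ideal_gen h /\ lead T v.
move/ideal_genP/(_ J): uI; apply; last first.
  move=> k; split; first exact: mem_ideal_gen.
  exists (fun j => (j == k)%:R), (fun=> 0).
  have -> : \sum_j (j == k)%:R *: h j = h k.
    rewrite (bigD1 k) //= eqxx scale1r big1 ?addr0 // => j /negPf ->.
    by rewrite scale0r.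
  rewrite subrr linear0 sub0r; split=> //.
    by move=> _; apply: (is_ideal0 id1).
  rewrite big1 ?oppr0; first exact: (is_ideal0 idT).
  by move=> j _; rewrite mul0r.
split=> [|v w [vI vl] [wI wl]|a v [vI vl]|v a [vI vl]].
- split; first exact: rpred0.
  apply: (@lead_deep _ _ (fun=> 0)) => //; first by move=> _; apply: (is_ideal0 id1).
  rewrite linear0 sub0r big1 ?oppr0; first exact: (is_ideal0 idT).
  by move=> j _; rewrite mul0r.
- split; first exact: rpredB.
  by apply: leadD => //; rewrite -scaleN1r; apply: leadZ.
- split; first exact: gen_ideal_Ml.
  (* The constant $a_0$ only rescales the decomposition of [v], while $a_1 v$ has order $1 + 2 = 3$
     and its image lies in $MJ$ modulo $M^T$. *)
  have [a0 [a1 a1_ge ->]] := split1 a; rewrite mulrDl mulr_algl.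
  apply: leadD; first exact: leadZ.
  apply: leadM (abelM a1 v) (abelP _ _ vI a1_ge).
  exact: ncord_geM a1_ge (ideal_gen_ord2 vI).
- split; first exact: gen_ideal_Mr.
  have [a0 [a1 a1_ge ->]] := split1 a; rewrite mulrDr mulr_algr.
  apply: leadD; first exact: leadZ.
  have := abelP _ _ vI a1_ge; rewrite mulrC; apply: leadM (abelM v a1).
  exact: ncord_geM (ideal_gen_ord2 vI) a1_ge.
Qed.

End GeneratedIdealSeries.

(** * Linear algebra and the count of commutators *)

(** Since $(1 - QL) Q = Q - Q (LQ) = 0$, the rows of $1 - QL$ lie in the left kernel of [Q], whose
    dimension is $d - \mathrm{rank}\, Q \le d - r$. The rows of [B] form a basis of that kernel. *)
Lemma complement_of_left_inverse (K : fieldType) r d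
    (L : 'M[K]_(r, d)) (Q : 'M[K]_(d, r)) : L *m Q = 1%:M ->
  exists m (B : 'M[K]_(m, d)) (W : 'M[K]_(d, m)),
    (m + r <= d)%N /\ Q *m L + W *m B = 1%:M.
Proof.
move=> LQ; have rQ : (r <= \rank Q)%N.
  by have := @mulmx1_min_rank _ _ _ _ Q L (1%:M : 'M_r); rewrite mulmx1; apply.
have /submxP[W defW] : (1%:M - Q *m L <= row_base (kermx Q))%MS.
  by rewrite eq_row_base; apply/sub_kermxP; rewrite mulmxBl mul1mx -mulmxA LQ mulmx1 subrr.
exists (\rank (kermx Q)), (row_base (kermx Q)), W.
rewrite -defW addrC subrK mxrank_ker; split=> //.
by apply: leq_trans (leq_add (leqnn _) rQ) _; rewrite subnK ?rank_leq_row.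
Qed.

Lemma card_ord_pairs n : #|{: {p : 'I_n * 'I_n | (p.1 < p.2)%N}}| = 'C(n, 2).
Proof.
rewrite card_sig -sum1_card.
rewrite -(pair_big_dep xpredT (fun i j : 'I_n => (i < j)%N) (fun _ _ => 1%N)) /=.
rewrite (exchange_big_dep xpredT) //= -bin2_sum big_mkord.
apply: eq_bigr => j _.
rewrite -(big_ord_widen n (fun=> 1%N) (ltnW (ltn_ord j))).
by rewrite sum1_card card_ord.
Qed.

(** * The lower bound on the number of generators *)

Section Core.
Context (K : fieldType) (n d D : nat) (h : 'I_d -> ncseries K n).
Context (v : 'I_D -> ncseries K n).
Local Notation A := (ncseries K n).
Local Notation S := {mpoly K[n]}.
Local Notation x := (@ncX K n).

Hypothesis h2 : forall k, ncord_ge 2 (h k).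
Hypothesis comm_x : forall i j, x i * x j - x j * x i \in ideal_gen h.
Hypothesis span_v : forall m : 'X_{1..n}, exists c : 'I_D -> K,
  \prod_i x i ^+ m i - \sum_j c j *: v j \in ideal_gen h.

(** Each of the $\binom{n}{2}$ commutators has zero image, so it gives a linear combination of the
    images of the [h k] that lies in $MJ$ modulo $M^T$. These relations are independent, and
    Nakayama removes as many generators. *)
Lemma abel_gens T : exists m (g : 'I_m -> S),
  [/\ (m + 'C(n, 2) <= d)%N, forall l, mord_ge 1 (g l) &
      forall k, ideal_adjoin (mord_ge T) g (abel T (h k))].
Proof.
have idT := mord_ge_is_ideal K n T.
pose P : finType := {p : 'I_n * 'I_n | (p.1 < p.2)%N}.
have /choice [c /choice [b cbP]] (p : P) :=
  ideal_gen_lead h2 T (comm_x (val p).1 (val p).2).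
pose pr (s : 'I_#|P|) := val (enum_val s).
have pr_lt s : ((pr s).1 < (pr s).2)%N by apply: (valP (enum_val s)).
pose L := \matrix_(s < #|P|, k < d) c (enum_val s) k.
pose Q := \matrix_(k < d, s < #|P|)
  h k (FMonom [:: (pr s).1; (pr s).2]).
(* The coefficients of the length-two words are compared: the remainder of each commutator has order
   three, so it contributes none. *)
have LQ : L *m Q = 1%:M.
  apply/matrixP => s t; rewrite !mxE.
  have [_ lead3 _] := cbP (enum_val s).
  move: (lead3 (FMonom [:: (pr t).1; (pr t).2]) isT).
  rewrite ncsED ncsEN ncX_swap ?pr_lt //.
  have -> : ((pr s).1 == (pr t).1) && ((pr s).2 == (pr t).2) = (s == t).
    by rewrite -xpair_eqE -!surjective_pairing (inj_eq val_inj) (inj_eq enum_val_inj).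
  move=> /eqP; rewrite subr_eq0 => /eqP ->.
  have evalE w : (\sum_k c (enum_val s) k *: h k) w =
      \sum_k c (enum_val s) k * h k w.
    by apply: (big_morph (fun f : A => f w)).
  by rewrite evalE; apply: eq_bigr => k _; rewrite !mxE.
have [m [B [W [mr QLWB]]]] := complement_of_left_inverse LQ.
pose F k := abel T (h k).
pose g l := \sum_k B l k *: F k.
have idg := ideal_adjoin_is_ideal idT g.
exists m, g; split.
- by rewrite -card_ord_pairs.
- move=> l; apply: (is_ideal_sum (mord_ge_is_ideal K n 1)) => k _.
  by apply/mord_geZ/abel_ge/(@ncord_geW _ _ 1 2).
apply: (mord_nakayama (T := T)) => // [p|k]; first exact: ideal_adjoin_sub.
have mulE q (X : 'M[K]_(d, q)) (Y : 'M[K]_(q, d)) :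
    \sum_j (X *m Y) k j *: F j = \sum_s X k s *: \sum_j Y s j *: F j.
  under eq_bigr do rewrite mxE scaler_suml.
  rewrite exchange_big; apply: eq_bigr => s _.
  by rewrite scaler_sumr; apply: eq_bigr => j _; rewrite scalerA.
have FE : F k = \sum_s Q k s *: (\sum_j L s j *: F j) + \sum_l W k l *: g l.
  rewrite -!mulE -big_split /=.
  transitivity (\sum_j (Q *m L + W *m B) k j *: F j); last first.
    by apply: eq_bigr => j _; rewrite [in LHS]mxE scalerDl.
  under eq_bigr do rewrite QLWB mxE.
  rewrite (bigD1 k) //= eqxx scale1r big1 ?addr0 // => j.
  by rewrite eq_sym => /negPf ->; rewrite scale0r.
have scaleg a p : ideal_adjoin (mord_ge T) g p ->
    ideal_adjoin (mord_ge T) g (a *: p).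
  by rewrite -mul_mpolyC; apply: (is_idealMl idg).
(* The sign arises because the commutator is the combination [c] of the [h j] plus its remainder: as
   its image vanishes, $(LF)_s \equiv - \sum_j b_{s,j} F_j$ modulo $M^T$. *)
exists (fun j => - \sum_s Q k s *: b (enum_val s) j).
  move=> j; have id1 := mord_ge_is_ideal K n 1.
  apply: (is_idealN id1); apply: (is_ideal_sum id1) => s _.
  by have [b1 _ _] := cbP (enum_val s); apply: mord_geZ.
under eq_bigr do rewrite mulNr mulr_suml.
rewrite sumrN opprK exchange_big -/(F k) FE addrAC -big_split /=.
apply: (is_idealD idg); last first.
  apply: (is_ideal_sum idg) => l _; apply: scaleg.
  exact: (ideal_adjoin_gen idT).
apply: (is_ideal_sum idg) => s _.
under [X in _ + X]eq_bigr do rewrite -scalerAl.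
rewrite -scaler_sumr -scalerDr; apply/scaleg/ideal_adjoin_sub.
have [_ _] := cbP (enum_val s); rewrite linearB /= => csT.
have -> : \sum_j L s j *: F j = abel T (\sum_j c (enum_val s) j *: h j).
  by rewrite linear_sum; apply: eq_bigr => j _; rewrite mxE linearZ.
move: csT; set y := abel T (_ - _); set z := abel T _; set w := \sum_j _ => csT.
rewrite -[z + w](subrK y) -[_ - y]opprB; apply: (is_idealD idT).
  by apply: (is_idealN idT); rewrite opprD addrA.
exact: abel_comm.
Qed.

Lemma le_card_gens : ('C(n.+1, 2) <= d)%N.
Proof.
(* The degree [T] is fixed first, since [m] and [g] depend on it; the growth bound therefore has to
   hold for all $m < n$ at once. *)
have [T growth] := bmultinom_growth n D.
have idT := mord_ge_is_ideal K n T.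
have [m [g [mr g1 gh]]] := abel_gens T.
rewrite leqNgt; apply/negP => d_small.
have mn : (m < n)%N.
  rewrite -(ltn_add2r 'C(n, 2)); apply: leq_ltn_trans mr _.
  by rewrite binS bin1 addnC in d_small.
have idg := ideal_adjoin_is_ideal idT g.
have Qgen (u : A) : u \in ideal_gen h -> ideal_adjoin (mord_ge T) g (abel T u).
  move=> /(abel_ideal_gen T)[e uT].
  rewrite -[abel T u](subrK (\sum_l e l * abel T (h l))).
  apply: (is_idealD idg); first exact: ideal_adjoin_sub.
  by apply: (is_ideal_sum idg) => k _; apply: (is_idealMl idg).
have span p : exists (c : 'I_D -> K) (e : 'I_m -> S),
    mord_ge T (p - \sum_j c j *: abel T (v j) - \sum_l e l * g l).
  suff [c Zc] : exists c : 'I_D -> K,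
      ideal_adjoin (mord_ge T) g (p - \sum_j c j *: abel T (v j)) by exists c.
  (* It suffices to treat monomials, which up to order [T] are the images of the ordered products in
     [span_v]. *)
  elim/mpolyind: p => [|a m' p _ _ [c pc]].
    exists (fun=> 0); rewrite big1 ?subr0; first exact: (is_ideal0 idg).
    by move=> j _; rewrite scale0r.
  have [e me] := span_v m'; exists (fun j => a * e j + c j).
  have -> : \sum_j (a * e j + c j) *: abel T (v j) =
      a *: (\sum_j e j *: abel T (v j)) + \sum_j c j *: abel T (v j).
    rewrite scaler_sumr -big_split; apply: eq_bigr => j _.
    by rewrite scalerDl scalerA.
  rewrite opprD addrACA -scalerBr; apply: (is_idealD idg) => //.
  rewrite -mul_mpolyC; apply: (is_idealMl idg).
  rewrite -['X_[m']](subrK (abel T (\prod_i x i ^+ m' i))) -addrA.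
  apply: (is_idealD idg).
    apply: ideal_adjoin_sub; rewrite -opprB; apply: (is_idealN idT).
    exact: abel_mon.
  have := Qgen _ me; rewrite linearB linear_sum /=.
  by under [\sum_j _]eq_bigr do rewrite linearZ.
have := card_bmultinom_le (span_adic g1 span) (erefl _).
rewrite card_prod card_ord leqNgt; apply/negP; rewrite negbK.
exact: growth.
Qed.

End Core.

(** * Reduction of both algebras to power series *)

Section Transfer.
Context (K : fieldType) (n d : nat) (F : lalgType K).
Context (iota : {lrmorphism F -> ncseries K n}) (x : 'I_n -> F).
Hypothesis iota_x : forall i, iota (x i) = ncX K i.
Context (f : 'I_d -> F).

Lemma ideal_gen_morph u : u \in ideal_gen f -> iota u \in ideal_gen (iota \o f).
Proof.
pose J u := iota u \in ideal_gen (iota \o f).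
move=> /ideal_genP/(_ J); apply; last by move=> k; apply: (mem_ideal_gen (iota \o f)).
split=> [|v w Jv Jw|a v Jv|v a Jv]; rewrite /J.
- by rewrite rmorph0 rpred0.
- by rewrite rmorphB rpredB.
- by rewrite rmorphM; apply: gen_ideal_Ml.
- by rewrite rmorphM; apply: gen_ideal_Mr.
Qed.

(** The commutator and spanning relations hold in [F] modulo its own ideal, and [iota] carries them
    into the ideal generated by the images of the generators. *)
Lemma commutative_quotient_card_gens :
    (forall k, ncord_ge 2 (iota (f k))) ->
    finite_dim (ideal_quotient (ideal_gen f)) ->
    commutative (@GRing.mul (ideal_quotient (ideal_gen f))) ->
  ('C(n.+1, 2) <= d)%N.
Proof.
move=> f2 [D [[phi phi_lin [psi phiK psiK]]]] comm.
pose pi := quot_pi (ideal_gen f).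
(* Lifts to [F] of the basis of the quotient given by the coordinate map [phi]. *)
pose v j : F := repr (psi (delta_mx 0 j)).
apply: (@le_card_gens K n d D (iota \o f) (iota \o v)) => // [i j|m].
  rewrite -!iota_x -!rmorphM -rmorphB; apply: ideal_gen_morph.
  by apply/quot_piP; rewrite !rmorphM comm.
pose u := \prod_i x i ^+ m i.
exists (fun j => phi (pi u) 0 j).
have -> : \prod_i ncX K i ^+ m i = iota u.
  by rewrite rmorph_prod; apply: eq_bigr => i _; rewrite rmorphXn /= iota_x.
have -> : \sum_j phi (pi u) 0 j *: (iota \o v) j =
    iota (\sum_j phi (pi u) 0 j *: v j).
  by rewrite linear_sum; apply: eq_bigr => j _; rewrite linearZ.
rewrite -rmorphB; apply: ideal_gen_morph; apply/quot_piP.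
apply: (can_inj phiK).
pose phiL : {linear _ -> _} := HB.pack phi (GRing.isLinear.Build _ _ _ _ phi phi_lin).
rewrite linear_sum -[phi]/(phiL : _ -> _) linear_sum [LHS]row_sum_delta.
apply: eq_bigr => j _; rewrite !linearZ /=; congr (_ *: _).
by rewrite psiK.
Qed.

End Transfer.

End CommutativeImage.

(** * The free algebra inside the power series algebra *)

Section MalgSeries.
Context (K : fieldType) (n : nat).
Local Notation A := (ncseries K n).
Local Notation M := {malg K[{fmonom 'I_n}]}.

Definition malg_series (f : M) : A := fun w => mcoeff w f.

Lemma malg_series_is_linear : linear malg_series.
Proof.
by move=> a f g; apply/funext => w; rewrite /malg_series mcoeffD mcoeffZ.
Qed.

HB.instance Definition _ :=
  GRing.isLinear.Build K M A _ malg_series malg_series_is_linear.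

(** A word [w] can equal [u v] only when it is cut at position [size u], so at most one term of the
    convolution survives. *)
Lemma malg_seriesM_monom (a b : K) (u v : {fmonom 'I_n}) :
  malg_series (<< a *g u >> * << b *g v >>) =
  malg_series << a *g u >> * malg_series << b *g v >>.
Proof.
rewrite malgM_def fgmulUU; apply/funext => w.
rewrite ncsEM /malg_series mcoeffU /=.
transitivity (\sum_(i < (size w).+1)
    a * b *+ ((u == FMonom (take i w)) && (v == FMonom (drop i w)))); last first.
  by apply: eq_bigr => i _; rewrite !mcoeffU mulrnAl mulrnAr -mulrnA mulnb andbC.
rewrite -val_eqE /= fmM; case: eqP => [uvw|uv].
  have uw : (size u < (size w).+1)%N by rewrite -uvw ltnS size_cat leq_addr.
  have uE : FMonom (take (size u) w) = u by rewrite -uvw take_size_cat ?fmK.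
  have vE : FMonom (drop (size u) w) = v by rewrite -uvw drop_size_cat ?fmK.
  rewrite (bigD1 (Ordinal uw)) //= uE vE !eqxx big1 ?addr0 // => i.
  rewrite -val_eqE /= -[u == _]val_eqE /= => /negP ne_i.
  case: eqP => // def_u; case: ne_i.
  by rewrite def_u size_takel ?eqxx // -ltnS.
rewrite big1 // => i _; rewrite -!val_eqE /=; case: eqP => //= def_u.
by case: eqP => // def_v; case: uv; rewrite def_u def_v cat_take_drop.
Qed.

Lemma malg_series_is_monoid_morphism : monoid_morphism malg_series.
Proof.
split.
  apply/funext => w; rewrite /malg_series mcoeff1 ncsE1 fdeg_eq0.
  by [].
move=> f g; rewrite [f]monalgE [g]monalgE mulr_suml !linear_sum mulr_suml /=.
apply: eq_bigr => u _; rewrite !mulr_sumr linear_sum; apply: eq_bigr => v _.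
exact: malg_seriesM_monom.
Qed.

HB.instance Definition _ :=
  GRing.isMonoidMorphism.Build M A malg_series malg_series_is_monoid_morphism.

End MalgSeries.

Theorem theorem0p2 (K : fieldType) (n : nat) (hn : (2 <= n)%N) (d : nat)
    (hd : d = if n == 2%N then 2%N else ((n * n.+1) %/ 2 - 2)%N) :
  (forall f : 'I_d -> {malg K[{fmonom 'I_n}]},
     (forall (i : 'I_d) (w : {fmonom 'I_n}),
        mcoeff w (f i) != 0 -> (2 <= fdeg w)%N) ->
     finite_dim (ideal_quotient (ideal_gen f)) ->
     ~ commutative (@GRing.mul (ideal_quotient (ideal_gen f))))
  /\
  (forall f : 'I_d -> ncseries K n,
     (forall (i : 'I_d) (w : {fmonom 'I_n}),
        f i w != 0 -> (2 <= fdeg w)%N) ->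
     finite_dim (ideal_quotient (ideal_gen f)) ->
     ~ commutative (@GRing.mul (ideal_quotient (ideal_gen f)))).
Proof.
(* For $n = 2$ this is $2 < 3$; otherwise $d = \binom{n+1}{2} - 2$, and the strict inequality holds
   because the binomial is positive. *)
have d_small : (d < 'C(n.+1, 2))%N.
  have bin_gt1 : (1 < 'C(n.+1, 2))%N.
    by apply: (@leq_trans 'C(3, 2)); rewrite // leq_bin2l.
  rewrite {}hd; case: eqP => [-> //|_].
  by rewrite -[n]/(n.+1.-1) mulnC divn2 -bin2 ltn_subrL (ltnW bin_gt1).
split=> f f2 fin comm; move: d_small; rewrite ltnNge => /negP; apply.
  pose x i : {malg K[{fmonom 'I_n}]} := << FMonom [:: i] >>.
  apply: (@commutative_quotient_card_gens K n d _ (@malg_series K n) x _ f) => //.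
    by move=> i; apply/funext => w; rewrite /x /= /malg_series mcoeffU1 eq_sym.
  by move=> k w; apply: contraTeq => /f2; rewrite -leqNgt.
apply: (@commutative_quotient_card_gens K n d _ idfun (@ncX K n) _ f) => //.
by move=> k w; apply: contraTeq => /f2; rewrite -leqNgt.
Qed.
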